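(* Let $(X,Y,c=\langle\cdot,\cdot\rangle)$ be a dual system, let $C\subset X$ be non-empty, let $K\subset X$ be non-empty and convex, and let $F:K\to Y$. Let $\tau$ be a Hausdorff locally convex topology on $X$ such that $K$ is $\tau$-compact. Assume that $$\forall\omega\in R(F),\ \forall x\in\operatorname{conv}C,\ \exists\kappa\in K,\quad \langle\kappa-x,\omega\rangle\le0.$$ Assume further that, for every $a\in\operatorname{conv}C$, the map $$K\times K\ni(x,x')\mapsto\langle a-x',F(x)\rangle$$ is $\tau\times\tau$-upper semicontinuous. Then there exists $x\in K$ such that $$\forall u\in\operatorname{conv}C,\quad \langle u-x,F(x)\rangle\ge0.$$ In particular, the upper semicontinuity assumption is satisfied if there exists a topology $\mu$ on $R(F)$ such that $c:K\times R(F)\to\mathbb{R}$ is $\tau\times\mu$-lower semicontinuous, $F:(K,\tau)\to(R(F),\mu)$ is continuous, and $\mu$ is stronger than $\sigma(Y,C)$ on $R(F)$.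
   Context: A dual system $(X,Y,c=\langle\cdot,\cdot\rangle)$ consists of real vector spaces $X,Y$ and a bilinear form $\langle\cdot,\cdot\rangle:X\times Y\to\mathbb{R}$; no separation is assumed. $c(x,y):=\langle x,y\rangle$ and $R(F):=F(K)$. $\sigma(Y,C)$ is the weakest topology on $Y$ making all linear forms $y\mapsto\langle x,y\rangle$, $x\in C$, continuous. ''$\mu$ is stronger than $\sigma(Y,C)$ on $R(F)$'' means that $\mu$ contains the trace of $\sigma(Y,C)$ on $R(F)$ (not necessarily strictly). *)

(* Defs.v *)
From HB Require Import structures.
From mathcomp Require Import all_boot all_order all_algebra.
From mathcomp Require Import all_classical all_reals all_analysis.

Set Implicit Arguments.
Unset Strict Implicit.
Unset Printing Implicit Defensive.

Import Order.TTheory GRing.Theory Num.Theory.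
Import numFieldNormedType.Exports.

Local Open Scope classical_set_scope.
Local Open Scope ring_scope.

Definition conv_hull (R : realType) (X : lmodType R) (C : set X) : set X :=
  smallest (@convex_set R X) C.

(* Mirrors the library's [lower_semicontinuous]. *)
Definition upper_semicontinuous (T : topologicalType) (R : numFieldType)
    (f : T -> \bar R) :=
  forall x a, (f x < a%:E)%E ->
    exists2 V, nbhs x V & forall y, V y -> (f y < a%:E)%E.

Definition corestrict_range (S T : Type) (f : S -> T) (x : S) : range f :=
  SigSub (mem_set (imageT f x)).

(* The initial topology for the family of linear forms [c x], [x] in [C],
   obtained as the supremum of their individual initial topologies. *)
Definition sigma_topology (R : realType) (X Y : lmodType R)
    (c : X -> Y -> R) (C : set X) : topologicalType :=
  sup_topology (fun x : C =>
    Topological.on (initial_topology (c (set_val x)))).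

(* The trace is taken along the inclusion of [A] in [Y]; [mu] is a bundled
   topological structure on the type of elements of [A]. *)
Definition finer_than_trace (Y : topologicalType) (A : set Y)
    (mu : Topological A) :=
  forall U : set Y, open U ->
    @open (Topological.Pack mu) (set_val @^-1` U : set A).

(* Main.v *)
(* Suppose no solution exists. Upper semicontinuity and compactness give finitely
   many points u_i of conv C, a cover of K by closed sets N_i, and a convex
   neighbourhood D of 0 with <u_i - y, F x> < 0 whenever x is in N_i and y - x is
   in D. Cover K by finitely many translates y_j + E with cl E included in D. The
   sets B_ij of those x in N_i for which some k in K with k - y_j in cl E
   satisfies <u_i - k, F x> >= 0 are closed and cover K. By a covering theorem of
   Knaster-Kuratowski-Mazurkiewicz type there is a convex combination
   x = sum_ij l_ij y_j lying in B_ij as soon as l_ij > 0, say with witness k_ij.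
   Put k = sum_ij l_ij k_ij; then k - x is in D, so
   sum_ij l_ij <u_i - k, F x> is negative, although it is equal to
   sum_ij l_ij <u_i - k_ij, F x>, which is nonnegative.

   The covering theorem (equivalent to Brouwer's theorem) is obtained without
   triangulations, from Scarf's ordinal counterpart of Sperner's lemma applied
   to finer and finer grids of the simplex ordered by their coordinates. *)

Require Import Defs.
From mathcomp Require Import all_boot all_order all_algebra.
From mathcomp Require Import all_classical all_reals all_analysis.
From mathcomp Require Import lra.

Set Implicit Arguments.
Unset Strict Implicit.
Unset Printing Implicit Defensive.

Import Order.TTheory GRing.Theory Num.Theory.
Import numFieldNormedType.Exports.

Local Open Scope classical_set_scope.
Local Open Scope ring_scope.

(** * Combinatorics: dominant sets, Scarf's lemma and integer grids *)

Section Combinatorics.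
Local Open Scope nat_scope.
Local Open Scope set_scope.

Lemma even_sum (T : finType) (P : pred T) (F : T -> nat) :
  (forall x, P x -> ~~ odd (F x)) -> ~~ odd (\sum_(x | P x) F x).
Proof.
move=> h; elim/big_ind: _ => // x y; rewrite oddD.
by move=> /negbTE -> /negbTE ->.
Qed.

Section Replacement.
Variables (W I : finType) (r : I -> W -> nat).
Hypothesis r_inj : forall i, injective (r i).

(** For non-empty [P]: no element of [W] lies strictly above the minimum of [P] in every order at
    once. *)
Definition dominant (P : {set W}) :=
  [forall v, exists i, forall p in P, r i v <= r i p].

Lemma dominantP (P : {set W}) :
  reflect (forall v, exists i, forall p, p \in P -> r i v <= r i p)
          (dominant P).
Proof.
apply: (iffP forallP) => h v.
  by have /existsP[i /forall_inP ?] := h v; exists i.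
by have [i ?] := h v; apply/existsP; exists i; apply/forall_inP.
Qed.

(** Dominance at a point of [Q] makes it the minimum of some order, so [m] maps [I] onto [Q]. As [I]
    has one element more, exactly one collision [m i = m j] occurs, and deleting [i] or [j] leaves a
    bijection. *)
Lemma replacement_pair (Q : {set W}) (x0 : W) :
  x0 \in Q -> #|Q|.+1 = #|I| -> dominant Q ->
  exists i j : I, exists m : I -> W, [/\ i != j,
    forall k, m k \in Q, forall k q, q \in Q -> r k (m k) <= r k q &
    forall e, e \in [:: i; j] ->
      {in [pred k | k != e] &, injective m} /\
      (forall q, q \in Q -> exists2 k, k != e & m k = q)].
Proof.
move=> x0Q cQ /dominantP dQ.
pose m k := [arg min_(q < x0 in Q) r k q].
have mQ k : m k \in Q by rewrite /m; case: arg_minnP.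
have mle k q : q \in Q -> r k (m k) <= r k q.
  by rewrite /m; case: arg_minnP => // p _; apply.
have surj q : q \in Q -> exists k, m k = q.
  move=> qQ; have [k kq] := dQ q; exists k; apply: (r_inj (i := k)).
  by apply/eqP; rewrite eqn_leq mle// kq.
have imm : [set m k | k in [set: I]] = Q.
  apply/setP => q; apply/imsetP/idP => [[k _ ->]//|/surj[k <-]].
  by exists k.
have /injectivePn[i [j ij mij]] : ~~ injectiveb m.
  apply/injectiveP => mi; have := card_imset (mem [set: I]) mi.
  by rewrite imm cardsT -cQ => /n_Sn.
exists i, j, m; split=> // e eij.
have [e' e'e me'] : exists2 e', e' != e & m e' = m e.
  by move: eij; rewrite !inE => /orP[]/eqP->; [exists j; rewrite // eq_sym|exists i].
have sur q : q \in Q -> exists2 k, k != e & m k = q.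
  move=> /surj[k <-]; have [->|ke] := eqVneq k e; first by exists e'.
  by exists k.
split=> //.
have ime : [set m k | k in [set~ e]] = Q.
  apply/setP => q; apply/imsetP/idP => [[k _ ->]//|/sur[k ke <-]].
  by exists k; rewrite // !inE.
have /imset_injP : #|[set m k | k in [set~ e]]| == #|[set~ e]|.
  by rewrite ime cardsC1 -cQ.
by move=> inj k l ke le; apply: inj; rewrite !inE.
Qed.

(* As [Q] has one element less than there are orders, exactly two orders [i] and
   [j] share their minimum on [Q]. An element completes [Q] to a dominant set
   iff, for [e = i] or [e = j], it is the [e]-largest of the elements exceeding
   the minima of [Q] for all the other orders. *)
Lemma replacement_twice (Q : {set W}) (x0 : W) :
  x0 \in Q -> #|Q|.+1 = #|I| -> dominant Q ->
  (forall e, exists w, forall k, k != e -> exists2 q, q \in Q & r k q < r k w) ->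
  #|[set x | x \notin Q & dominant (x |: Q)]| = 2.
Proof.
move=> x0Q cQ dQ slack.
have [i [j [m [ij mQ mle hm]]]] := replacement_pair x0Q cQ dQ.
have {}dQ := dominantP _ dQ.
pose M e := [set v | [forall (k | k != e), r k (m k) < r k v]].
have inM e v : reflect (forall k, k != e -> r k (m k) < r k v) (v \in M e).
  by rewrite inE; exact: forall_inP.
have Mex e : exists w, w \in M e.
  have [w hw] := slack e; exists w; apply/inM => k /hw[q qQ].
  exact/leq_ltn_trans/mle.
have Mmax e : exists2 x, x \in M e & forall w, w \in M e -> r e w <= r e x.
  have [w wM] := Mex e; exists [arg max_(v > w in M e) r e v];
    by case: arg_maxnP.
have domP e x : e \in [:: i; j] -> x \in M e ->
    (forall w, w \in M e -> r e w <= r e x) ->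
    x \notin Q /\ dominant (x |: Q).
  move=> eij xM xmax; have [_ sur] := hm _ eij; split.
    apply/negP => /sur[k ke mk]; have /inM/(_ k ke) := xM.
    by rewrite mk ltnn.
  apply/dominantP => w.
  have [wM|/inM wM] := boolP (w \in M e).
    exists e => p; rewrite !inE => /orP[/eqP->|pQ]; first exact: xmax.
    apply: leq_trans (xmax _ wM) _.
    (* [x] exceeds the minima of all orders but [e], so the order in which dominance puts [x] below
       [Q] can only be [e]. *)
    have [k hk] := dQ x.
    have [->|ke] := eqVneq e k; first exact: hk.
    by have /inM/(_ k) := xM; rewrite eq_sym => /(_ ke); rewrite ltnNge hk.
  have /existsP[k] : [exists k, (k != e) && (r k w <= r k (m k))].
    rewrite -[X in is_true X]negbK negb_exists; apply/negP => /forallP h.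
    by apply: wM => k ke; have := h k; rewrite ke /= -ltnNge.
  case/andP=> ke kw; exists k => p; rewrite !inE => /orP[/eqP->|pQ].
    by apply: leq_trans kw (ltnW _); apply/inM: ke.
  exact: leq_trans kw (mle _ _ pQ).
have [x xM xmax] := Mmax i; have [y yM ymax] := Mmax j.
have [xQ xd] := domP i x (mem_head _ _) xM xmax.
have jij : j \in [:: i; j] by rewrite !inE eqxx orbT.
have [yQ yd] := domP j y jij yM ymax.
have xy : x != y.
  apply/eqP => xy; have [k hk] := dQ x.
  have : r k (m k) < r k x.
    have [ki|ki] := eqVneq k i; last by apply/inM: ki.
    by rewrite xy; move/inM: yM; apply; rewrite ki.
  by rewrite ltnNge hk.
have -> : [set x | x \notin Q & dominant (x |: Q)] = [set x; y].
  apply/setP => z; rewrite !inE; apply/andP/orP; last by case=> /eqP->.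
  case=> zQ /dominantP zd.
  suff [e eij [zM zmax]] : exists2 e, e \in [:: i; j] &
      z \in M e /\ forall w, w \in M e -> r e w <= r e z.
    move: eij; rewrite !inE => /orP[]/eqP ee; [left|right];
      apply/eqP; apply: (r_inj (i := e)); apply/eqP; rewrite eqn_leq zmax ?ee//.
      by rewrite xmax -?ee.
    by rewrite ymax -?ee.
  have [e he] := zd z.
  have zlt k : r k (m k) <= r k z -> r k (m k) < r k z.
    rewrite leq_eqVlt => /orP[/eqP/r_inj zk|//].
    by move: zQ; rewrite -zk mQ.
  (* In the enlarged set [z] is the minimum for [e], so each [m k] must be the minimum of an order
     other than [e]. For [k = e] this is a collision, which forces [e] to be [i] or [j]. *)
  have other k : exists2 l, m l = m k & r l (m l) < r l z /\ l != e.
    have [l hl] := zd (m k).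
    have lz : r l (m k) <= r l z by apply: hl; rewrite !inE eqxx.
    have ml : m l = m k.
      apply: (r_inj (i := l)); apply/eqP; rewrite eqn_leq mle//=.
      by apply: hl; rewrite !inE mQ orbT.
    exists l => //; have lt : r l (m l) < r l z by apply: zlt; rewrite ml.
    split=> //; apply: contraTneq lt => ->; rewrite -leqNgt.
    by apply: he; rewrite !inE mQ orbT.
  have eij : e \in [:: i; j].
    have [l ml [_ le]] := other e; apply: contraT; rewrite !inE negb_or.
    case/andP => ei ej; have [inji _] := hm i (mem_head _ _).
    have [injj _] := hm j jij.
    have [li|li] := eqVneq l i.
      by move: le; rewrite (injj l e) ?inE ?eqxx// li.
    by move: le; rewrite (inji l e) ?inE ?eqxx.
  exists e => //; have [inj _] := hm e eij.
  have zM : z \in M e.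
    apply/inM => k ke; have [l ml [lt le]] := other k.
    by rewrite -(inj l k).
  split=> // w /inM wM.
  have [k hk] := zd w.
  have [<-|ke] := eqVneq k e; first by apply: hk; rewrite !inE eqxx.
  by have := wM k ke; rewrite ltnNge hk// !inE mQ orbT.
by rewrite cards2 xy.
Qed.

End Replacement.

(** * Scarf's lemma, by counting doors *)

Section Scarf.
Variables (V I : finType) (f : I -> V -> nat) (c : V -> I) (v0 : V).

Let W := (V + I)%type.

(** Ties of [f i] are broken by the rank, so that [h i] is injective and refines [f i]. *)
Let h i v := f i v * #|V| + enum_rank v.

Let h_inj i : injective (h i).
Proof.
move=> v w /(congr1 (modn^~ #|V|)); rewrite /h !modnMDl.
by rewrite !modn_small//; move/val_inj/enum_rank_inj.
Qed.

Let h_le i v w : h i v <= h i w -> f i v <= f i w.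
Proof.
move=> hvw; rewrite leqNgt; apply/negP => fwv.
have : h i w < h i v.
  apply: (@leq_trans ((f i w).+1 * #|V|)).
    by rewrite /h mulSn addnC ltn_add2r ltn_ord.
  by apply: leq_trans (leq_addr _ _); rewrite leq_mul2r fwv orbT.
by rewrite ltnNge hvw.
Qed.

(* The slack element [inr i] is the smallest one for the [i]-th order and
   exceeds every element of [V] for the other orders; thus a subset of [W]
   encodes a subset of [V] together with a set of active orders, those whose
   slack element is absent. *)
Let r i (w : W) :=
  match w with
  | inl v => (h i v).+1
  | inr k => if k == i then 0 else (\max_v h i v).+2 + enum_rank k
  end.

Let r_inl i v k : k != i -> r i (inl v) < r i (inr k).
Proof.
move=> ki; rewrite /= (negbTE ki) addSn ltnS.
by apply: leq_trans (leq_addr _ _); rewrite ltnS leq_bigmax.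
Qed.

Let r_inj i : injective (r i).
Proof.
move=> [v|k] [w|l].
- by move=> /= [/h_inj->].
- have [->|li] := eqVneq l i; first by rewrite /= eqxx.
  by move=> e; have := r_inl v li; rewrite e ltnn.
- have [->|ki] := eqVneq k i; first by rewrite /= eqxx.
  by move=> e; have := r_inl w ki; rewrite e ltnn.
- rewrite /=; case: eqP => [->|_]; case: eqP => [->|_] //.
  by move=> /addnI/val_inj/enum_rank_inj->.
Qed.

Let lab (w : W) := match w with inl v => c v | inr k => k end.

Let i0 := c v0.

(** By cardinality, each label but [i0] is carried exactly once. *)
Let door (Q : {set W}) :=
  [&& #|Q|.+1 == #|I|, dominant r Q & lab @: Q == [set~ i0]].

Let Q0 : {set W} := [set inr k | k in [set~ i0]].

Let card_Q0 : #|Q0|.+1 = #|I|.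
Proof.
rewrite card_imset; last by move=> ? ? [].
by rewrite cardsC1 prednK//; apply/card_gt0P; exists i0.
Qed.

(** Dominance at the [i0]-largest element [v] of [V] needs an order whose slack is absent. Only [i0]
    qualifies, and the added element must then be [v] itself. *)
Let cells_Q0 : #|[set x | x \notin Q0 & dominant r (x |: Q0)]| = 1.
Proof.
pose v := [arg max_(v > v0) h i0 v].
have vmax w : h i0 w <= h i0 v by rewrite /v; case: arg_maxnP => // p _; apply.
have inQ0 k : (inr k \in Q0) = (k != i0).
  by rewrite mem_imset; [rewrite !inE|move=> ? ? []].
have inlQ0 w : (inl w \in Q0) = false by apply/imsetP => -[].
have -> : [set x | x \notin Q0 & dominant r (x |: Q0)] = [set inl v]; last first.
  by rewrite cards1.
apply/setP => x; rewrite !inE; apply/andP/eqP => [[xQ /dominantP xd]|->].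
  have [k hk] := xd (inl v).
  have kP : inr k \notin x |: Q0.
    by apply/negP => /hk; rewrite /= eqxx.
  move: kP; rewrite !inE negb_or inQ0 negbK => /andP[xk /eqP ki].
  case: x xd hk xk xQ => [w|l] xd hk xk; rewrite ?inlQ0 ?inQ0.
    move=> _; have := hk (inl w); rewrite !inE eqxx ki => /(_ isT) /=.
    rewrite ltnS => vw; congr inl; apply: (h_inj (i := i0)).
    by apply/eqP; rewrite eqn_leq vw vmax.
  by rewrite negbK => /eqP li; move: xk; rewrite li ki eqxx.
split; first by rewrite inlQ0.
apply/dominantP => -[w|k].
  exists i0 => -[u|l]; rewrite !inE ?inlQ0 ?inQ0 ?orbF.
    by move=> /eqP[->]; rewrite /= ltnS.
  by move=> /= li; rewrite ltnW// r_inl.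
by exists k => p _; rewrite /= eqxx.
Qed.

Let dominant_sub (P Q : {set W}) : Q \subset P -> dominant r P -> dominant r Q.
Proof.
move=> /fintype.subsetP QP /dominantP Pd; apply/dominantP => w.
by have [i hi] := Pd w; exists i => p /QP; apply: hi.
Qed.

Let door_Q0 : door Q0.
Proof.
rewrite /door card_Q0 eqxx/=; apply/andP; split.
  have : 0 < #|[set x | x \notin Q0 & dominant r (x |: Q0)]| by rewrite cells_Q0.
  case/card_gt0P => x; rewrite inE => /andP[_].
  exact/dominant_sub/finset.subsetUr.
by rewrite /Q0 -imset_comp imset_id.
Qed.

(** A door made of slacks alone is [Q0], so any other one contains an element of [V]. The slack
    [inr e] exceeds that element in all orders but [e], as replacement requires. *)
Let cells_door Q : door Q -> Q != Q0 ->
  #|[set x | x \notin Q & dominant r (x |: Q)]| = 2.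
Proof.
case/and3P => /eqP cQ dQ /eqP lQ QQ0.
have /existsP[v vQ] : [exists v, inl v \in Q].
  rewrite -[X in is_true X]negbK negb_exists; apply: contra QQ0 => /forallP noV.
  rewrite eqEcard -ltnS card_Q0 cQ leqnn andbT; apply/fintype.subsetP => -[v|k] wQ.
    by have := noV v; rewrite wQ.
  by rewrite mem_imset; [rewrite -lQ (imset_f lab wQ)|move=> ? ? []].
apply: (replacement_twice r_inj vQ) => // e; exists (inr e) => k ke.
by exists (inl v) => //; apply: r_inl; rewrite eq_sym.
Qed.

(** If removing [x] leaves a door's labels, then [lab x] is shared with exactly one other element
    [y], and only [x] and [y] can be so removed. *)
Let doors_of_cell (P : {set W}) : #|P| = #|I| -> lab @: P != [set: I] ->
  ~~ odd #|[set x in P | lab @: (P :\ x) == [set~ i0]]|.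
Proof.
move=> cP nfull; set D := [set _ in _ | _].
have [->|[x]] := finset.set_0Vmem D; first by rewrite cards0.
rewrite inE => /andP[xP /eqP lx].
have xlab : lab x != i0.
  apply: contra nfull => /eqP xi; rewrite -(finset.setD1K xP) imsetU1 lx xi.
  by apply/eqP/setP => k; rewrite !inE orbN.
have /imsetP[y yP xy] : lab x \in lab @: (P :\ x) by rewrite lx !inE.
have cPx : #|P :\ x| = #|[set~ i0]|.
  by apply/eqP; rewrite cardsC1 -cP (cardsD1 x P) xP.
have /imset_injP inj : #|lab @: (P :\ x)| == #|P :\ x| by rewrite lx cPx.
have /andP[yx yP'] : (y != x) && (y \in P) by rewrite -in_setD1.
suff -> : D = [set x; y] by rewrite cards2 eq_sym yx.
apply/setP => z; rewrite !inE; apply/andP/orP => [[zP /eqP lz]|[]/eqP->].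
- have [->|zx] := eqVneq z x; [by left|right].
  have /imsetP[t] : lab z \in lab @: (P :\ z).
    by rewrite lz -lx imset_f// !inE zx.
  rewrite !inE => /andP[tz tP] ztl.
  have [tx|tx] := eqVneq t x.
    by apply/eqP/inj; rewrite ?inE ?zx ?yx// ztl tx.
  by move: tz; rewrite (inj t z) ?inE ?zx ?tx ?tP ?zP// eqxx.
- by rewrite xP lx.
- rewrite yP'; split=> //; rewrite -lx finset.eqEsubset; apply/andP; split.
    apply/fintype.subsetP => k /imsetP[t]; rewrite !inE => /andP[ty tP] ->.
    have [->|tx] := eqVneq t x; first by rewrite xy imset_f// !inE yx.
    by rewrite imset_f// !inE tx.
  apply/fintype.subsetP => k /imsetP[t]; rewrite !inE => /andP[tx tP] ->.
  have [->|ty] := eqVneq t y; first by rewrite -xy imset_f// !inE eq_sym yx.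
  by rewrite imset_f// !inE ty.
Qed.

(* Parity: count the pairs of a dominant set of size [#|I|] and a door contained
   in it. Every door but [Q0] lies in two such sets and [Q0] in one, whereas a
   dominant set which does not carry all the labels contains zero or two doors. *)
Let full_cell : exists P : {set W},
  [/\ #|P| = #|I|, dominant r P & lab @: P = [set: I]].
Proof.
pose g (P : {set W}) := (#|P| == #|I|) && dominant r P.
apply: contrapT => nofull.
pose N := \sum_(P | g P) #|[set x in P | lab @: (P :\ x) == [set~ i0]]|.
have : ~~ odd N.
  apply: even_sum => P /andP[/eqP cP dP]; apply: doors_of_cell => //.
  by apply/eqP => lP; apply: nofull; exists P.
suff -> : N = \sum_(Q | door Q) #|[set x | x \notin Q & dominant r (x |: Q)]|.
  rewrite (bigD1 Q0) ?door_Q0//= cells_Q0 oddD.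
  suff /negbTE-> : ~~ odd (\sum_(Q | door Q && (Q != Q0))
      #|[set x | x \notin Q & dominant r (x |: Q)]|) by [].
  by apply: even_sum => Q /andP[dQ QQ]; rewrite cells_door.
rewrite /N; under eq_bigr do rewrite -sum1dep_card.
under [RHS]eq_bigr do rewrite -sum1dep_card.
rewrite !pair_big_dep/=.
(* Double counting: a cell with a removable element corresponds to a door with a completing
   element. *)
rewrite (reindex_onto (fun p : {set W} * W => (p.2 |: p.1, p.2))
                      (fun p => (p.1 :\ p.2, p.2))) => [|[P x]/=]; last first.
  by case/and3P=> _ xP _; rewrite finset.setD1K.
apply: eq_bigl => -[Q x] /=; rewrite /g /door xpair_eqE eqxx andbT !inE eqxx/=.
have [xQ|xQ] := boolP (x \in Q).
  rewrite andbF; apply/negbTE; rewrite negb_and orbC.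
  by apply/orP; left; apply/eqP => e; move: xQ; rewrite -e !inE eqxx.
rewrite finset.setU1K// eqxx andbT cardsU1 xQ add1n.
have [xd|] := boolP (dominant r (x |: Q)); last by rewrite !andbF.
by rewrite (dominant_sub (finset.subsetUr _ _) xd)/= !andbT.
Qed.

(** The non-slack part of a fully labelled cell works. An order witnessing dominance at [v] has its
    slack, which ranks lowest, outside the cell, so its label comes from an element of [V]. *)
Lemma scarf : exists s : {set V},
  forall v, exists2 i, i \in c @: s & forall t, t \in s -> f i v <= f i t.
Proof.
have [P [cP /dominantP dP lP]] := full_cell.
exists [set v | inl v \in P] => v.
have [i hi] := dP (inl v).
have iP : inr i \notin P by apply/negP => /hi; rewrite /= eqxx.
have /imsetP[[t|k] wP /= it] : i \in lab @: P by rewrite lP.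
  exists i; first by rewrite it imset_f// inE.
  by move=> u; rewrite inE => /hi; rewrite /= ltnS; exact: h_le.
by move: iP; rewrite it wP.
Qed.

End Scarf.

(** Scarf's lemma for the grid points of total [m], ordered by coordinates. The minima of [s] over
    the occurring labels [C] add up to nearly [m], so in each coordinate the points of [s] are close
    together, and coordinates outside [C] are below [#|C|]. *)
Lemma grid_labelling (I : finType) (i0 : I) (m : nat) (c : (I -> nat) -> I) :
  exists a : I -> nat, \sum_i a i = m /\
    forall i, #|I| <= a i -> exists b : I -> nat,
      [/\ \sum_i b i = m, c b = i &
          forall j, a j <= b j + #|I| /\ b j <= a j + #|I|].
Proof.
pose V := {a : {ffun I -> 'I_m.+1} | \sum_i a i == m}.
pose coef (i : I) (v : V) : nat := val v i.
have mkV (a : I -> nat) : \sum_i a i = m -> exists v : V, forall i, coef i v = a i.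
  move=> am; have lt i : a i < m.+1 by rewrite ltnS -am (bigD1 i)//= leq_addr.
  have avm : \sum_i [ffun i => Ordinal (lt i)] i == m.
    by apply/eqP; rewrite -[RHS]am; apply: eq_bigr => i _; rewrite ffunE.
  by exists (Sub [ffun i => Ordinal (lt i)] avm) => i; rewrite /coef SubK ffunE.
have sumV v : \sum_i coef i v = m by apply/eqP; exact: valP v.
have [v0 _] : exists v : V, forall i, coef i v = if i == i0 then m else 0.
  by apply: mkV; rewrite -big_mkcond big_pred1_eq.
have [s hs] := scarf coef (fun v => c (coef^~ v)) v0.
set C := [set c (coef^~ v) | v in s] in hs.
have [t0 t0s] : exists t, t \in s.
  by have [i /imsetP[t ts _] _] := hs v0; exists t.
pose mu i := coef i [arg min_(t < t0 in s) coef i t].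
have mule i t : t \in s -> mu i <= coef i t.
  by move=> ts; rewrite /mu; case: arg_minnP => // p _; exact.
have muat i : exists2 t, t \in s & coef i t = mu i.
  by rewrite /mu; case: arg_minnP => // p ps _; exists p.
(* Otherwise some grid point would exceed all the minima over [s]. *)
have mult : m < \sum_(i in C) mu i + #|C|.
  rewrite ltnNge; apply/negP => lem.
  pose u i := if i \in C then (mu i).+1 else 0.
  have uE : \sum_i u i = \sum_(i in C) mu i + #|C|.
    rewrite -sum1_card -big_split/= [RHS]big_mkcond/=.
    by apply: eq_bigr => i _; rewrite addn1.
  (* The mass still missing from [m] is put on one coordinate. *)
  pose i1 := c (coef^~ t0).
  have [v hv] : exists v : V,
      forall i, coef i v = u i + (if i == i1 then m - \sum_i u i else 0).
    by apply: mkV; rewrite big_split/= -[X in _ + X]big_mkcond big_pred1_eq subnKC// uE.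
  have [i iC hi] := hs v; have [t ts ti] := muat i.
  by have := hi t ts; rewrite hv ti /u iC addSn ltnNge leq_addr.
have CI : #|C| <= #|I| by exact: max_card.
have sumC t j : t \in s ->
    (if j \in C then coef j t - mu j else coef j t) < #|C|.
  move=> ts; rewrite -(ltn_add2l (\sum_(i in C) mu i)).
  apply: leq_ltn_trans mult; rewrite -[leqRHS](sumV t).
  case: ifPn => jC.
    rewrite (bigD1 j)//= addnAC subnKC ?mule//.
    rewrite [leqRHS](bigD1 j)//= leq_add2l.
    rewrite [leqRHS](bigID (mem C))/=; apply: leq_trans (leq_addr _ _).
    rewrite [leqRHS](eq_bigl (fun i => (i \in C) && (i != j))).
      by apply: leq_sum => i _; exact: mule.
    by move=> i; rewrite andbC.
  rewrite [leqRHS](bigD1 j)//= addnC leq_add2l [leqRHS](bigID (mem C))/=.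
  apply: leq_trans (leq_addr _ _).
  rewrite [leqRHS](eq_bigl (fun i => i \in C)).
    by apply: leq_sum => i _; exact: mule.
  by move=> i; case: eqVneq => //= ->; rewrite (negbTE jC).
have close t t' j : t \in s -> t' \in s -> coef j t <= coef j t' + #|I|.
  move=> ts t's; have := sumC t j ts; case: ifPn => jC h.
    rewrite -leq_subLR; apply: leq_trans CI; apply: leq_trans (ltnW h).
    by rewrite leq_sub2l// mule.
  by apply: leq_trans (leq_trans (ltnW h) CI) (leq_addl _ _).
exists (coef^~ t0); split=> // i hi.
have /imsetP[t ts it] : i \in C.
  apply: contraLR hi => iC; rewrite -ltnNge; have := sumC t0 i t0s.
  by rewrite (negbTE iC) => h; exact: leq_trans h CI.
by exists (coef^~ t); split=> // j; split; exact: close.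
Qed.

End Combinatorics.

(** * The covering theorem on the simplex *)

Lemma continuous_sumr (T : topologicalType) (M : TopologicalZmodule.type)
    (I : finType) (f : I -> T -> M) :
  (forall i, continuous (f i)) -> continuous (fun x => \sum_i f i x).
Proof.
move=> fc x; rewrite /continuous_at.
elim: (index_enum I) => [|i s IH].
  by under eq_fun do rewrite big_nil; rewrite big_nil; exact: cvg_cst.
under eq_fun do rewrite big_cons; rewrite big_cons.
apply: (@continuous2_cvg _ _ _ _ _ _ _ _ (fun a b : M => a + b)); [|exact: fc|exact: IH].
exact: (@add_continuous M (_, _)).
Qed.

Definition simplex (R : realType) n : set 'rV[R]_n :=
  [set a | (forall i, 0 <= a ord0 i) /\ \sum_i a ord0 i = 1].

Lemma closed_simplex (R : realType) n : closed (@simplex R n).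
Proof.
have -> : @simplex R n = (\bigcap_i [set a | 0 <= a ord0 i]) `&`
    [set a | \sum_i a ord0 i = 1].
  by apply/seteqP; split=> a [h1 h2]; split=> // i; [move=> _; exact: h1|exact: h1].
apply: closedI; first apply: closed_bigI => i _.
  have /continuous_closedP := @coord_continuous R 1 n ord0 i.
  by move=> /(_ [set x | 0 <= x]) h; apply: h; exact: closed_ge.
have /continuous_closedP : continuous (fun a : 'rV[R]_n => \sum_i a ord0 i : R).
  by apply: (@continuous_sumr _ R^o) => i; exact: coord_continuous.
by move=> /(_ [set x | x = 1]) h; apply: h; exact: closed_eq.
Qed.

Lemma compact_simplex (R : realType) n : compact (@simplex R n).
Proof.
apply: (@subclosed_compact _ _
  [set a : 'rV[R]_n | forall i, `[0, 1]%classic (a ord0 i)]).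
- exact: closed_simplex.
- by apply: (@rV_compact R n (fun=> `[0, 1]%classic)) => i; exact: segment_compact.
- move=> a [a0 a1] i /=; rewrite in_itv/= a0 -a1 (bigD1 i)//= lerDl.
  exact: sumr_ge0.
Qed.

(** A cluster point of the approximate solutions on grids of mesh [1 / m.+1] is an exact one,
    because the sets are closed. *)
Lemma simplex_labelling (R : realType) n (A : 'I_n -> set 'rV[R]_n) :
  (0 < n)%N -> (forall i, closed (A i)) ->
  (forall a, simplex a -> exists i, A i a) ->
  exists2 a, simplex a & forall i, 0 < a ord0 i -> A i a.
Proof.
move=> n0 Acl Acov; pose i0 : 'I_n := Ordinal n0.
pose grid m (b : 'I_n -> nat) : 'rV[R]_n := \row_i ((b i)%:R / m.+1%:R).
have gridP m b : (\sum_i b i)%N = m.+1 -> simplex (grid m b).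
  move=> bm; split=> [i|]; first by rewrite mxE divr_ge0.
  under eq_bigr do rewrite mxE.
  by rewrite -mulr_suml -natr_sum bm divff.
have /choice[a_ ha] m : exists a, simplex a /\
    forall i, n%:R / m.+1%:R <= a ord0 i -> exists2 b, A i b &
      forall j, `|a ord0 j - b ord0 j| <= n%:R / m.+1%:R.
  (* Off the simplex the label is arbitrary; [i0] is its default. *)
  have /choice[c cP] (b : 'I_n -> nat) :
      exists i, simplex (grid m b) -> A i (grid m b).
    have [/Acov[i Ai]|nb] := pselect (simplex (grid m b)); first by exists i.
    by exists i0.
  have [b [bm hb]] := grid_labelling i0 m.+1 c.
  exists (grid m b); split; first exact: gridP.
  move=> i; rewrite mxE ler_pM2r ?invr_gt0// ler_nat => bi.
  have := hb i; rewrite card_ord => /(_ bi)[b' [b'm b'i hb']].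
  exists (grid m b'); first by rewrite -b'i; apply: cP; exact: gridP.
  move=> j; rewrite !mxE -mulrBl normrM [`|_^-1|]ger0_norm ?invr_ge0//.
  rewrite ler_pM2r ?invr_gt0//; have [h1 h2] := hb' j.
  by rewrite ler_distlC lerBlDr -!natrD !ler_nat h1 h2.
have aS : \forall k \near \oo, simplex (a_ k).
  by apply: nearW => k; case: (ha k).
have [p [pS pcl]] := @compact_simplex R n (a_ @ \oo) _ aS.
exists p => // i pi; apply: Acl => U /nbhs_ballP[e/= e0 eU].
(* Half of [e] leaves room for two errors; half of the coordinate keeps the [i]-th coordinate of
   [a_ k] above the threshold [n%:R / k.+1%:R]. *)
pose d := Num.min (e / 2) (p ord0 i / 2).
have d0 : 0 < d by rewrite lt_min !divr_gt0.
have near_small : \forall k \near \oo, n%:R / k.+1%:R < d.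
  have dn0 : 0 < d / n%:R by rewrite divr_gt0// ltr0n.
  near=> k; rewrite mulrC -ltr_pdivlMr ?ltr0n//; near: k.
  exact: (near_infty_natSinv_lt (PosNum dn0)).
(* Clustering yields only a point; [B] makes it remember an index of small mesh. *)
pose B := [set a | exists2 k, a = a_ k & n%:R / k.+1%:R < d].
have Fa : \forall k \near \oo, B (a_ k) by near=> k; exists k => //; near: k.
have [a [[k -> kd] /= pa]] := pcl B _ Fa (nbhsx_ballx p d d0).
have pka j : `|p ord0 j - a_ k ord0 j| < d by case: pa => _ /(_ ord0 j).
have de : d <= e / 2 by rewrite ge_min lexx.
have [//|b Ab kb] := (ha k).2 i.
  have dp : d <= p ord0 i / 2 by rewrite ge_min lexx orbT.
  apply: le_trans (ltW kd) _; have := pka i; rewrite ltr_distlC => /andP[/ltW pd _].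
  apply: le_trans pd; lra.
exists b; split => //; apply: eU; split=> // r j; rewrite ord1 /ball/=.
rewrite -(subrKA (a_ k ord0 j)) (le_lt_trans (ler_normD _ _))//.
rewrite [ltRHS]splitr ltr_leD//; first exact: lt_le_trans (pka j) de.
exact: le_trans (kb j) (le_trans (ltW kd) de).
Unshelve. all: end_near. Qed.

(** * Convex combinations, compactness and closed projections *)

Lemma convex_setP (R : realType) (M : lmodType R) (A : set M) :
  convex_set A <-> forall x y (t : R), A x -> A y -> 0 <= t -> t <= 1 ->
    A (t *: x + (1 - t) *: y).
Proof.
split=> [cA x y t Ax Ay t0 t1|cA x y l].
  by have /set_mem := cA x y (Itv01 t0 t1) (mem_set Ax) (mem_set Ay).
by move=> /set_mem Ax /set_mem Ay; apply/mem_set/cA.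
Qed.

Lemma convex_set_sum (R : realType) (M : lmodType R) (A : set M) (I : finType)
    (l : I -> R) (z : I -> M) :
  convex_set A -> (forall i, 0 <= l i) -> \sum_i l i = 1 ->
  (forall i, A (z i)) -> A (\sum_i l i *: z i).
Proof.
move=> /convex_setP cA l0 l1 Az.
have [i0 _] : exists i : I, true.
  apply: contrapT => /forallNP nI; move/eqP: l1; rewrite big1 => [|i _].
    by rewrite eq_sym oner_eq0.
  by case: (nI i).
(* A partial sum is its total weight times a point of [A]; when that weight is zero, any point of
   [A] serves. *)
suff H (s : seq I) : exists2 y, A y &
    \sum_(i <- s) l i *: z i = (\sum_(i <- s) l i) *: y.
  by have [y Ay ->] := H (index_enum I); rewrite l1 scale1r.
elim: s => [|i s [y Ay IH]]; first by exists (z i0); rewrite // !big_nil scale0r.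
rewrite !big_cons IH; set S := \sum_(_ <- _) _.
have S0 : 0 <= S by exact: sumr_ge0.
have [/eqP|lS] := eqVneq (l i + S) 0.
  rewrite paddr_eq0// => /andP[/eqP-> /eqP->].
  by exists y; rewrite // !addr0 !scale0r addr0.
have lS0 : 0 < l i + S by rewrite lt_neqAle eq_sym lS addr_ge0.
exists (l i / (l i + S) *: z i + (1 - l i / (l i + S)) *: y).
  apply: cA => //; first by rewrite divr_ge0// addr_ge0.
  by rewrite ler_pdivrMr// mul1r lerDl.
rewrite scalerDr !scalerA; congr (_ *: _ + _ *: _); first by rewrite mulrC divfK.
by rewrite mulrBr mulr1 [X in _ - X]mulrC divfK// addrAC subrr add0r.
Qed.

Lemma compact_finite_cover (T : topologicalType) (K : set T) (N : T -> set T) :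
  compact K -> (forall x, K x -> nbhs x (N x)) ->
  exists2 s : seq T, (forall x, x \in s -> K x) &
    forall x, K x -> exists2 y, y \in s & N y x.
Proof.
move=> /compact_near_coveringP/near_covering_withinP Kc NK.
(* The filter of finite sequences directed by inclusion turns near covering into the existence of a
   finite subcover. *)
pose G : set_system (seq T) :=
  [set P | exists s0 : seq T, forall s, {subset s0 <= s} -> P s].
have FG : Filter G.
  split; first by exists [::].
  - move=> P Q [s Ps] [t Qt]; exists (s ++ t) => u su; split.
      by apply: Ps => x xs; apply: su; rewrite mem_cat xs.
    by apply: Qt => x xs; apply: su; rewrite mem_cat xs orbT.
  - by move=> P Q PQ [s Ps]; exists s => t /Ps; exact: PQ.
have [|s hs] := Kc _ G (fun s x => exists2 y, y \in s /\ K y & N y x) FG.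
  move=> x Kx; exists (N x, [set s | x \in s]) => /=.
    by split; [exact: NK|exists [:: x] => s; apply; exact: mem_head].
  by move=> [y s] /= [Ny xs] _; exists x.
exists [seq x <- s | `[< K x >]].
  by move=> x; rewrite mem_filter => /andP[/asboolP].
move=> x /(hs s (fun _ => id))[y [ys Ky] Ny].
by exists y; rewrite // mem_filter ys andbT; exact/asboolP.
Qed.

Lemma continuous_scale (R : realType) (X : tvsType R) (v : X) :
  continuous (fun t : R => t *: v).
Proof.
move=> t; apply: (@continuous_comp R^o (R^o * X)%type X
  (fun t => (t, v)) (fun z => z.1 *: z.2)); last exact: scale_continuous.
by apply: (@cvg_pair _ _ _ _ (nbhs (t : R^o))); [exact: cvg_id|exact: cvg_cst].
Qed.

(** The cover is pulled back to the simplex along barycentric coordinates. Several indices may share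
    a point, which lets one point carry several labels. *)
Lemma convex_combination_labelling (R : realType) (X : tvsType R) (I : finType)
    (z : I -> X) (B : I -> set X) :
  (0 < #|I|)%N -> (forall i, closed (B i)) ->
  (forall l : I -> R, (forall i, 0 <= l i) -> \sum_i l i = 1 ->
     exists i, B i (\sum_i l i *: z i)) ->
  exists l : I -> R, [/\ forall i, 0 <= l i, \sum_i l i = 1 &
    forall i, 0 < l i -> B i (\sum_i l i *: z i)].
Proof.
move=> I0 Bcl Bcov.
pose g (a : 'rV[R]_#|I|) := \sum_i a ord0 (enum_rank i) *: z i.
have gc : continuous g.
  apply: (@continuous_sumr _ X) => i a.
  apply: (@continuous_comp _ R X (fun a : 'rV[R]_#|I| => a ord0 (enum_rank i))
    (fun t => t *: z i)); first exact: coord_continuous.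
  exact: continuous_scale.
have sumE (a : 'rV[R]_#|I|) : \sum_i a ord0 (enum_rank i) = \sum_j a ord0 j.
  by rewrite [RHS](reindex enum_rank)//; apply: onW_bij; exact: enum_rank_bij.
have [||a [a0 a1] ha] := @simplex_labelling R #|I|
    (fun j => g @^-1` B (enum_val j)) I0.
- by move=> j; apply: (continuous_closedP g).1 => //; exact: Bcl.
- move=> a [a0 a1]; have [||i Bi] := Bcov (fun i => a ord0 (enum_rank i)) => //.
    by rewrite sumE.
  by exists (enum_rank i); rewrite /= enum_rankK.
exists (fun i => a ord0 (enum_rank i)); split=> //; first by rewrite sumE.
by move=> i /ha /=; rewrite enum_rankK.
Qed.

Lemma nbhs0_addr (R : realType) (X : tvsType R) (x : X) (U : set X) :
  nbhs x U -> \forall y \near x & v \near (0 : X), U (y + v).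
Proof. by rewrite -{1}(addr0 x); exact: (@add_continuous X (x, 0)). Qed.

Lemma continuous_subr (R : realType) (X : tvsType R) (z : X) :
  continuous (fun x : X => x - z).
Proof.
move=> x; apply: (@continuous_comp X (X * X)%type X
  (fun x => (x, z)) (fun z => z.1 - z.2)); last exact: sub_continuous.
by apply: cvg_pair; [exact: cvg_id|exact: cvg_cst].
Qed.

(** Tube lemma: failure of [P] is a relatively open condition, and compactness of [L] makes it
    uniform in [y]. *)
Lemma closed_compact_proj (T T' : topologicalType) (K : set T) (L : set T')
    (P : T -> T' -> Prop) :
  closed K -> compact L ->
  (forall x y, K x -> L y -> ~ P x y ->
     \forall x' \near x & y' \near y, K x' -> L y' -> ~ P x' y') ->
  closed [set x | K x /\ exists2 y, L y & P x y].
Proof.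
move=> Kcl /compact_near_coveringP/near_covering_withinP Lc PN x xcl.
have Kx : K x.
  by apply: Kcl => U /xcl[x' [[Kx' _] Ux']]; exists x'.
split=> //; apply: contrapT => nP.
have : \forall x' \near x, L `<=` (fun y => K x' -> ~ P x' y).
  apply: Lc => y Ly; have [|[U V] /= [xU yV] UV] := PN x y Kx Ly.
    by move=> Pxy; apply: nP; exists y.
  exists (V, U) => // -[y' x'] /= [Vy' Ux'] Ly' Kx'.
  exact: (UV (x', y')).
by move=> /xcl[x' [[Kx' [y Ly Pxy]]]] /(_ y Ly Kx').
Qed.

(** * The variational inequality *)

(** [F] is total and semicontinuity is stated at level 0 relative to [K], so that no subspace
    topology intervenes. *)
Lemma variational_inequality (R : realType) (X : tvsType R) (Y : lmodType R)
    (c : {bilinear X -> Y -> R | *%R & *%R}) (A K : set X) (F : X -> Y) :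
  K !=set0 -> convex_set K -> hausdorff_space X -> compact K ->
  (forall x a, K x -> A a -> exists2 k, K k & c (k - a) (F x) <= 0) ->
  (forall a x y, A a -> K x -> K y -> c (a - y) (F x) < 0 ->
     \forall x' \near x & y' \near y, K x' -> K y' -> c (a - y') (F x') < 0) ->
  exists2 x, K x & forall a, A a -> 0 <= c (a - x) (F x).
Proof.
move=> [x0 Kx0] Kconv HX Kc Kex Kusc; apply: contrapT => noVI.
have Kcl : closed K := compact_closed HX Kc.
(* [uN x] packs the point [u], a region where the form is negative, and a neighbourhood of [x] whose
   closure lies in the interior of that region. Outside [K] its value is arbitrary. *)
have /choice[uN uNP] (x : X) : exists uN : X * set X * set X, K x ->
    [/\ A uN.1.1, nbhs x uN.2, (forall y, closure uN.2 y -> nbhs y uN.1.2) &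
      forall x' y', K x' -> K y' -> uN.1.2 x' -> uN.1.2 y' ->
        c (uN.1.1 - y') (F x') < 0].
  have [Kx|nK] := pselect (K x); last by exists (x, setT, setT) => /nK.
  have [u Au ux] : exists2 u, A u & c (u - x) (F x) < 0.
    apply: contrapT => nu; apply: noVI; exists x => // a Aa.
    by rewrite leNgt; apply/negP => ax; apply: nu; exists a.
  have [[U V] /= [xU xV] UV] := Kusc u x x Au Kx Kx ux.
  have xUV : nbhs x (U `&` V)^°.
    by apply: nbhs_interior; exact: filterI.
  have [N xN NUV] := uniform_regular xUV.
  exists (u, U `&` V, N) => _; split => //= x' y' Kx' Ky' [Ux' _] [_ Vy'].
  exact: (UV (x', y')).
have [s1 s1K s1cov] := compact_finite_cover (N := fun x => (uN x).2) Kc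
  (fun x Kx => let: And4 _ h _ _ := uNP x Kx in h).
pose p1 (i : 'I_(size s1)) := tnth (in_tuple s1) i.
have p1K i : K (p1 i) by apply: s1K; exact: mem_tnth.
pose u i := (uN (p1 i)).1.1; pose N i := closure (uN (p1 i)).2.
have uA i : A (u i) by have [] := uNP _ (p1K i).
(* Compactness of [K] intersected with [N i] makes the admissible shifts [v] independent of [x]. *)
have Dgood : \forall v \near (0 : X), forall i x, K x -> N i x -> K (x + v) ->
    c (u i - (x + v)) (F x) < 0.
  apply: filter_forall => i.
  have /compact_near_coveringP/near_covering_withinP cKN : compact (K `&` N i).
    by apply: compact_closedI => //; exact: closed_closure.
  have [_ _ NU Ulow] := uNP _ (p1K i).
  have : \forall v \near (0 : X),
      K `&` N i `<=` (fun x => (uN (p1 i)).1.2 (x + v)).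
    apply: cKN => x [Kx Nx]; have := nbhs0_addr (NU x Nx).
    by apply: filterS => -[y v].
  apply: filterS => v Dv x Kx Nx Kxv.
  by apply: Ulow => //; [exact: nbhs_singleton (NU x Nx)|exact: Dv].
have [D [Dconv D0 Dlow]] : exists D : set X, [/\ convex_set D, nbhs 0 D &
    forall v, D v -> forall i x, K x -> N i x -> K (x + v) -> c (u i - (x + v)) (F x) < 0].
  have [Bs Bsconv [Bsop Bsbasis]] := @locally_convex R X.
  have [D [BD D0] Dsub] := Bsbasis 0 _ Dgood.
  exists D; split => //; first exact/Bsconv/mem_set.
  by apply: open_nbhs_nbhs; split => //; exact: Bsop.
have [E E0 ED] := uniform_regular D0.
have Ecov (x : X) : K x -> nbhs x [set y | E (y - x)].
  by move=> _; apply: (@continuous_subr R X x x E); rewrite subrr.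
have [s2 s2K s2cov] := compact_finite_cover Kc Ecov.
pose p2 (j : 'I_(size s2)) := tnth (in_tuple s2) j.
have p2K j : K (p2 j) by apply: s2K; exact: mem_tnth.
pose L j := K `&` [set k | closure E (k - p2 j)].
pose B (ij : 'I_(size s1) * 'I_(size s2)) :=
  [set x | (K `&` N ij.1) x /\
           exists2 k, L ij.2 k & 0 <= c (u ij.1 - k) (F x)].
have BK x : K x -> exists ij, B ij x.
  move=> Kx; have [y ys Ny] := s1cov x Kx.
  have [i yi] : exists i, y = p1 i by apply/tnthP.
  have [k Kk kx] := Kex x (u i) Kx (uA i).
  have [z zs Ez] := s2cov k Kk.
  have [j zj] : exists j, z = p2 j by apply/tnthP.
  exists (i, j); split => /=.
    by split => //; apply: subset_closure; rewrite -yi.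
  exists k; first by split => //=; apply: subset_closure; rewrite -zj.
  by rewrite -(opprB k) linearNl oppr_ge0.
have Bcl ij : closed (B ij).
  apply: closed_compact_proj.
  - by apply: closedI => //; exact: closed_closure.
  - apply: compact_closedI => //.
    apply: (continuous_closedP _).1; first exact: continuous_subr.
    exact: closed_closure.
  - move=> x k [Kx _] [Kk _] /negP; rewrite -ltNge => xk.
    have := Kusc _ x k (uA ij.1) Kx Kk xk.
    apply: filterS => -[x' k'] /= h [Kx' _] [Kk' _].
    by apply/negP; rewrite -ltNge; exact: h.
have [||l [l0 l1 lB]] :=
    convex_combination_labelling (z := fun ij => p2 ij.2) _ Bcl.
- by have [ij _] := BK _ Kx0; apply/card_gt0P; exists ij.
- by move=> l l0 l1; apply: BK; exact: convex_set_sum.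
set x := \sum_ij _ in lB.
have Kx : K x by exact: convex_set_sum.
have /choice[k kP] ij : exists k, [/\ K k, D (k - p2 ij.2) &
    0 < l ij -> 0 <= c (u ij.1 - k) (F x)].
  have [lp|lp] := ltP 0 (l ij).
    have [_ [k [Kk Ek] ck]] := lB ij lp.
    by exists k; split => //; exact: ED.
  (* An index of zero weight gets the centre itself, with displacement [0] in [D]. *)
  exists (p2 ij.2); split=> //; rewrite subrr; exact: nbhs_singleton.
pose k0 := \sum_ij l ij *: k ij.
have Kk0 : K k0 by apply: convex_set_sum => // ij; have [] := kP ij.
(* [k0] and [x] use the same weights, so their difference is a convex combination of points of
   [D]. *)
have Dk0 : D (k0 - x).
  rewrite /k0 /x -sumrB; under eq_bigr do rewrite -scalerBr.
  by apply: convex_set_sum => // ij; have [] := kP ij.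
have low ij : 0 < l ij -> c (u ij.1 - k0) (F x) < 0.
  move=> lp; have := Dlow _ Dk0 ij.1 x Kx; rewrite addrC subrK; apply => //.
  by have [[]] := lB ij lp.
have : \sum_ij l ij * c (u ij.1 - k ij) (F x) =
       \sum_ij l ij * c (u ij.1 - k0) (F x).
  under eq_bigr do rewrite linearBl mulrBr.
  under [RHS]eq_bigr do rewrite linearBl mulrBr.
  rewrite !sumrB -[in RHS]mulr_suml l1 mul1r; congr (_ - _).
  rewrite /k0 linear_sumlz; apply: eq_bigr => ij _.
  by rewrite linearZl_LR.
(* Zero separates the two sides; strictness on the right needs one positive weight. *)
apply/eqP; rewrite gt_eqF//; apply: (@lt_le_trans _ _ 0).
  have [ij lij] : exists ij, 0 < l ij.
    apply: contrapT => /forallNP nl; move/eqP: l1; rewrite big1.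
      by rewrite eq_sym oner_eq0.
    by move=> ij _; apply/eqP; rewrite eq_le l0 andbT leNgt; apply/negP.
  rewrite (bigD1 ij)//= -[ltRHS](addr0 0) ltr_leD//.
    by rewrite nmulr_llt0// low.
  apply: sumr_le0 => ij' _; have := l0 ij'; rewrite le_eqVlt => /orP[/eqP<-|lp].
    by rewrite mul0r.
  by rewrite ltW// nmulr_llt0// low.
apply: sumr_ge0 => ij _; have := l0 ij; rewrite le_eqVlt => /orP[/eqP<-|lp].
  by rewrite mul0r.
by rewrite mulr_ge0//; have [_ _ ->] := kP ij.
Qed.

(** * Subspace topologies and the theorem *)

Lemma nbhs_set_val (T : topologicalType) (K : set T) (x : K) (U : set K) :
  nbhs x U -> \forall y \near set_val x, forall k : K, set_val k = y -> U k.
Proof.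
move=> [_ [/= [V Vop <-]] Vx VU].
have : nbhs (set_val x) V by exact: open_nbhs_nbhs.
by apply: filterS => y Vy k ky; apply: VU; rewrite /preimage/= ky.
Qed.

(** The points [a] with continuous pairing form a convex set containing [C], hence containing its
    hull. *)
Lemma continuous_pairing (R : realType) (X Y : lmodType R)
    (c : {bilinear X -> Y -> R | *%R & *%R}) (C : set X) (T : topologicalType)
    (F : T -> Y) (mu : Topological (range F)) :
  continuous (corestrict_range F : T -> Topological.Pack mu) ->
  finer_than_trace (Y := sigma_topology c C) mu ->
  forall a, conv_hull C a -> continuous (fun x => c a (F x)).
Proof.
move=> Fc fine.
suff : conv_hull C `<=` [set a | continuous (fun x => c a (F x))] by [].
apply: smallest_sub.
  apply/convex_setP => a b t ac bc t0 t1 x /=.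
  under eq_fun do rewrite linearDl !linearZl_LR.
  by apply: cvgD; apply: cvgMr; [exact: ac|exact: bc].
move=> a Ca; apply/continuousP => O Oop.
pose i : C := SigSub (mem_set Ca).
have Uop : @open (sigma_topology c C) (c a @^-1` O).
  rewrite openE => y Oy.
  pose Tc (x : C) := Topological.on (initial_topology (c (set_val x))).
  have /cvg_sup yi : nbhs (y : sup_topology Tc) --> (y : sup_topology Tc) by [].
  apply: (yi i); apply: open_nbhs_nbhs; split => //=.
  by exists O.
by have /continuousP/(_ _ (fine _ Uop)) := Fc.
Qed.

Theorem theorem34 (R : realType) (X : tvsType R) (Y : lmodType R)
    (c : {bilinear X -> Y -> R | *%R & *%R})
    (C : set X) (K : set X) (F : K -> Y) :
  C !=set0 -> K !=set0 -> convex_set K ->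
  hausdorff_space X -> compact K ->
  (forall w, range F w -> forall x, conv_hull C x ->
     exists2 k, K k & c (k - x) w <= 0) ->
  let usc_hypothesis := forall a, conv_hull C a ->
    upper_semicontinuous
      (fun p : K * K => (c (a - set_val p.2) (F p.1))%:E) in
  (usc_hypothesis ->
     exists x : K, forall u, conv_hull C u -> 0 <= c (u - set_val x) (F x)) /\
  ((exists mu : Topological (range F),
      [/\ lower_semicontinuous
            (fun p : K * Topological.Pack mu =>
               (c (set_val p.1) (set_val (p.2 : range F)))%:E),
          continuous (corestrict_range F : K -> Topological.Pack mu) &
          finer_than_trace (Y := sigma_topology c C) mu]) ->
   usc_hypothesis).
Proof.
move=> _ K0 Kconv HX Kc Kex usc; split=> [Kusc|[mu [lsc Fc fine]] a Ca].
  (* [F] is extended by [0] outside [K]. *)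
  pose G x := oapp F 0 (insub x : option K).
  have GF (k : K) : G (set_val k) = F k by rewrite /G set_valE valK.
  have KP x : K x -> exists k : K, x = set_val k.
    by move=> Kx; exists (SigSub (mem_set Kx)).
  have [||x Kx hx] :=
    @variational_inequality R X Y c (conv_hull C) K G K0 Kconv HX Kc.
  - by move=> _ a /KP[k ->] Ca; rewrite GF; apply: Kex => //; exists k.
  - move=> a _ _ Ca /KP[x ->] /KP[y ->]; rewrite GF => xy0.
    have [|V [[U1 U2] /= [xU yU] UV] VP] := Kusc a Ca (x, y) 0.
      by rewrite lte_fin.
    exists ([set z | forall k : K, set_val k = z -> U1 k],
            [set z | forall k : K, set_val k = z -> U2 k]).
      by split; exact: nbhs_set_val.
    move=> [x' y'] /= [Ux' Uy'] /KP[k kx'] /KP[l ly'].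
    rewrite kx' ly' GF; have := VP (k, l) (UV (k, l) _).
    rewrite lte_fin; apply; split; [exact: Ux'|exact: Uy'].
  by have [k kx] := KP x Kx; exists k => u /hx; rewrite kx GF.
move=> [x y] r; rewrite lte_fin/= => axy.
have ac := continuous_pairing Fc fine Ca.
(* Half of the gap: the term in [a] rises by less than [d] and the term in [y] falls by less than
   [d]. *)
pose d := (r - c (a - set_val y) (F x)) / 2.
have d0 : 0 < d by rewrite divr_gt0// subr_gt0.
have [|V [[U1 U2] /= [yU xU] UV] VP] :=
    lsc (y, corestrict_range F x) (c (set_val y) (F x) - d).
  by rewrite lte_fin ltrBlDr ltrDl.
have Fx : nbhs x (corestrict_range F @^-1` U2) by exact: Fc.
have ax : \forall x' \near x, c a (F x') < c a (F x) + d.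
  apply: (ac x [set t | t < c a (F x) + d]); apply: open_nbhs_nbhs.
  by split; [exact: open_lt|rewrite /= ltrDl].
pose U x' := c a (F x') < c a (F x) + d /\ U2 (corestrict_range F x').
exists ([set x' | U x'] `*` U1).
  exists ([set x' | U x'], U1) => //.
  by split=> //; exact: filterI.
move=> [x' y'] /= [[ax' Ux'] Uy'].
have := VP (y', corestrict_range F x') (UV (_, _) (conj Uy' Ux')).
rewrite !lte_fin/= !linearBl => yx'.
have dE : d + d = r - (c a (F x) - c (set_val y) (F x)).
  by rewrite -linearBl [RHS]splitr.
lra.
Qed.
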